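(* Let $(M,d)$ be a metric space and let $\mathcal{P},\mathcal{Q}:(\mathbb{R},\leq)\to\mathbf{Dyn}^0_n(M)$ be two persistence dynamical systems. Then $$d_B(\mathrm{SymB}(\mathcal{P}),\mathrm{SymB}(\mathcal{Q}))\leq d_I(\mathcal{P},\mathcal{Q}),$$ where $\mathrm{SymB}$ denotes the construction that assigns to each persistence dynamical system its symmetry barcode.
   Context: $\mathcal{S}_n(M)$ is the category whose objects are $n$-configurations of $M$ (subsets of $n$ distinct points, $n\ge2$) and whose morphisms $f:X\to Y$ are bijections that are restrictions of homeomorphisms $\tilde f:M\to M$ with $\tilde f(X)=Y$. A persistence $n$-configuration is a functor $\mathcal{F}:(\mathbb{R},\leq)\to\mathcal{S}_n(M)$ with values $\mathcal{F}_t$. $\mathrm{Sym}(X)=\{\pi\in\mathrm{Iso}(M)\mid\pi(X)=X\}$, its elements being regarded as permutations of $X$ by restriction. $\mathbf{Dyn}^0_n(M)$: objects are pairs $(\mathcal{F},r)$ with $\mathcal{F}$ a persistence $n$-configuration and $r\in\mathbb{R}$ such that $\mathcal{F}_t=\mathcal{F}_r$ for all $t\geq r$. There is a morphism $\phi:(\mathcal{F},r)\to(\mathcal{G},s)$ whenever $r\leq s$ and $\mathcal{F}_t=\mathcal{G}_t$ for all $t\leq r$; its components are $\phi_t=\mathrm{id}$ for $t\leq r$, $\phi_t=\mathcal{G}_{r\leq t}$ for $r<t\leq s$, $\phi_t=\mathcal{G}_{r\leq s}$ for $t>s$. A persistence dynamical system is a functor $(\mathbb{R},\leq)\to\mathbf{Dyn}^0_n(M)$.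 Fix a field $\mathbb{K}$. The functor $\mathcal{M}:\mathbf{Dyn}^0_n(M)\to\mathbf{Vec}_{\mathbb{K}}$ sends $(\mathcal{F},r)$ to $\mathbb{K}[\mathrm{Sym}(\mathcal{F}_r)]$ (vector space with basis $\mathrm{Sym}(\mathcal{F}_r)$) and a morphism $(\mathcal{F},r)\to(\mathcal{G},s)$ to the linear map sending a basis element $\sigma$ to $g_{r,s}\circ\sigma\circ g_{r,s}^{-1}$ if $\sigma\in L_{r,s}$ and to $0$ otherwise. Here $g_{u,v}:\mathcal{G}_u\to\mathcal{G}_v$ are the structure maps of $\mathcal{G}$ (note $\mathcal{F}_r=\mathcal{G}_r$) and $L_{r,s}$ is the subgroup of those $\sigma\in\mathrm{Sym}(\mathcal{G}_r)$ such that for every finite decomposition $r=t_0<\dots<t_k=s$ all conjugates $g_{r,t_i}\circ\sigma\circ g_{r,t_i}^{-1}$ lie in $\mathrm{Sym}(\mathcal{G}_{t_i})$. The symmetry barcode $\mathrm{SymB}(\mathcal{P})$ of a persistence dynamical system $\mathcal{P}$ is the barcode (multiset of intervals of the interval decomposition) of the persistence module $\mathcal{M}\circ\mathcal{P}:(\mathbb{R},\leq)\to\mathbf{Vec}_{\mathbb{K}}$. $d_B$ is the bottleneck distance of barcodes. Interleaving distance: for functors $\mathcal{P},\mathcal{Q}:(\mathbb{R},\leq)\to\mathfrak{C}$, $(\Sigma^x\mathcal{P})(a)=\mathcal{P}(a+x)$, $\Sigma^x|_{\mathcal{P}}:\mathcal{P}\Rightarrow\Sigma^x\mathcal{P}$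 is given by structure maps; $\mathcal{P},\mathcal{Q}$ are $\varepsilon$-interleaved if there are natural transformations $\phi:\mathcal{P}\Rightarrow\Sigma^\varepsilon\mathcal{Q}$, $\psi:\mathcal{Q}\Rightarrow\Sigma^\varepsilon\mathcal{P}$ with $(\Sigma^\varepsilon\psi)\circ\phi=\Sigma^{2\varepsilon}|_{\mathcal{P}}$, $(\Sigma^\varepsilon\phi)\circ\psi=\Sigma^{2\varepsilon}|_{\mathcal{Q}}$; $d_I$ is the infimum of such $\varepsilon\ge 0$. *)

(* Defs.v *)
From HB Require Import structures.
From mathcomp Require Import all_boot all_order all_algebra all_fingroup finmap.
From mathcomp Require Import all_classical all_reals all_analysis.

Set Implicit Arguments.
Unset Strict Implicit.
Unset Printing Implicit Defensive.

Import Order.TTheory GRing.Theory Num.Theory.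

Local Open Scope classical_set_scope.
Local Open Scope ring_scope.

Record category := Category {
  obj :> Type;
  hom : obj -> obj -> Type;
  idm : forall a, hom a a;
  comp : forall a b c, hom b c -> hom a b -> hom a c;
  compm1 : forall a b (f : hom a b), comp f (idm a) = f;
  comp1m : forall a b (f : hom a b), comp (idm b) f = f;
  compA : forall a b c d (h : hom c d) (g : hom b c) (f : hom a b),
    comp h (comp g f) = comp (comp h g) f }.
Arguments idm {C} a : rename.
Arguments comp {C x y z} g f : rename.

Record functor (C D : category) := Functor {
  fobj :> obj C -> obj D;
  fmap : forall a b, hom a b -> hom (fobj a) (fobj b);
  fmap1 : forall a, fmap (idm a) = idm (fobj a);
  fmapM : forall a b c (g : hom b c) (f : hom a b),
    fmap (comp g f) = comp (fmap g) (fmap f) }.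
Arguments fmap {C D} F {a b} f : rename.

Record nat_trans (C D : category) (F G : functor C D) := NatTrans {
  component :> forall a, hom (F a) (G a);
  naturality : forall a b (f : hom a b),
    comp (component b) (fmap F f) = comp (fmap G f) (component a) }.

Lemma nat_trans_eq (C D : category) (F G : functor C D) (u v : nat_trans F G) :
  (forall a, u a = v a) -> u = v.
Proof.
case: u v => [u nu] [v nv] /= uv; have E : u = v by exact: functional_extensionality_dep.
by subst v; congr NatTrans; exact: Prop_irrelevance.
Qed.

Section NatTransComp.
Variables (C D : category) (F G H : functor C D).

Definition nat_id : nat_trans F F.
Proof. by exists (fun a => idm (F a)) => a b f; rewrite comp1m compm1. Defined.

Definition nat_comp (v : nat_trans G H) (u : nat_trans F G) : nat_trans F H.
Proof.
exists (fun a => comp (v a) (u a)) => a b f.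
by rewrite -compA naturality compA naturality compA.
Defined.

End NatTransComp.
Arguments nat_id {C D} F.

Definition functor_comp (C D E : category) (G : functor D E) (F : functor C D) :
  functor C E.
Proof.
exists (fun a => G (F a)) (fun a b f => fmap G (fmap F f)) => [a|a b c g f].
  by rewrite !fmap1.
by rewrite !fmapM.
Defined.

Section RealPoset.
Variable R : realType.

Definition real_poset : category.
Proof.
exists R (fun s t : R => s <= t) (fun s : R => lexx s)
  (fun s t u (tu : t <= u) (st : s <= t) => le_trans st tu) => *;
  exact: bool_irrelevance.
Defined.

Definition rle (s t : real_poset) (st : (s : R) <= t) : hom s t := st.


Variable C : category.

Definition shift (x : R) (F : functor real_poset C) : functor real_poset C.
Proof.
exists (fun a : R => F (a + x))
  (fun (a b : R) (ab : a <= b) => fmap F (rle (lerD ab (lexx x)))).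
- by move=> a; rewrite -fmap1; congr (fmap F _); exact: bool_irrelevance.
- move=> a b c g f; rewrite -fmapM; congr (fmap F _); exact: bool_irrelevance.
Defined.

(* [a + e + e] stands for [a + 2e]: the two points are only propositionally
   equal, and [F (a <= a + e + e)] is the structure map of the 2e-shift. *)
Definition interleaved (e : R) (F G : functor real_poset C) : Prop :=
  exists (u : nat_trans F (shift e G)) (v : nat_trans G (shift e F)),
    forall (a : R) (h : a <= a + e + e),
      comp (v (a + e)) (u a) = fmap F (rle h) /\
      comp (u (a + e)) (v a) = fmap G (rle h).

Definition interleaving_distance (F G : functor real_poset C) : \bar R :=
  ereal_inf [set e%:E | e in [set e : R | 0 <= e /\ interleaved e F G]].

End RealPoset.
Arguments rle {R s t}.

Section Vec.
Variable K : fieldType.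

Lemma linear_eq (U V : lmodType K) (f g : {linear U -> V}) :
  (forall x, f x = g x) -> f = g.
Proof.
move=> /funext; case: f g => f [[f1] [f2]] [g [[g1] [g2]]] /= fg; subst g.
by congr (GRing.Linear.Pack (GRing.Linear.Class _ _));
  [congr GRing.isNmodMorphism.Axioms_|congr GRing.isScalable.Axioms_];
  exact: Prop_irrelevance.
Qed.

Definition Vec : category.
Proof.
exists (lmodType K) (fun U V : lmodType K => {linear U -> V})
  (fun U : lmodType K => (@idfun U : {linear U -> U}))
  (fun (U V W : lmodType K) (g : {linear V -> W}) (f : {linear U -> V}) =>
     (g \o f : {linear U -> W})).
all: by move=> *; exact: linear_eq.
Defined.

End Vec.

Section Barcode.
Variables (R : realType) (K : fieldType).

Definition persistence_module := functor (real_poset R) (Vec K).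

Record bar := Bar {
  bar_set :> set R;
  bar_nonempty : bar_set !=set0;
  bar_interval : is_interval bar_set }.

(* A multiset of intervals is an indexed family; distinct indices carrying the
   same interval account for its multiplicity. *)
Record barcode := Barcode {
  bar_index :> choiceType;
  bar_of : bar_index -> bar }.

(* K_J has fibre ['rV_1] over J and ['rV_0] elsewhere; [pid_mx 1] is the
   identity when both endpoints lie in J and zero otherwise. *)
Definition interval_module (J : bar) : persistence_module.
Proof.
exists (fun t : R => 'rV[K]_(t \in bar_set J) : lmodType K)
  (fun (s t : R) (_ : s <= t) =>
     (mulmxr (pid_mx 1 : 'M[K]_(s \in bar_set J, t \in bar_set J))
       : {linear 'rV[K]_(s \in bar_set J) -> 'rV[K]_(t \in bar_set J)})).
- move=> s; apply: linear_eq => /=.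
  by case: (s \in _) => v; [rewrite pid_mx_1 mulmx1|apply/rowP; case].
- rewrite /= => s t u tu st; apply: linear_eq => v /=; rewrite -mulmxA mul_pid_mx.
  have : s \in bar_set J -> u \in bar_set J -> t \in bar_set J.
    move=> /set_mem Js /set_mem Ju; apply: mem_set.
    by apply: (bar_interval Js Ju); apply/andP.
  case: (s \in _) v => v; case: (u \in _); case: (t \in _) => //= H;
    (by have := H isT isT) || by congr (v *m _); apply/matrixP; case=> [[|?]] ? [[|?]] ?.
Defined.

(* Internal direct sum: each vector is in exactly one way a sum of images of
   finitely many vectors of the summands. *)
Definition is_direct_sum (I : choiceType) (W : I -> persistence_module)
    (V : persistence_module) (inj : forall i, nat_trans (W i) V) : Prop :=
  forall (t : R) (x : V t : lmodType K),
    exists! w : forall i, (W i t : lmodType K),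
      finite_set [set i | w i != 0] /\
      x = \sum_(i \in [set: I]) (inj i t : {linear _ -> _}) (w i).

Definition is_barcode_of (B : barcode) (V : persistence_module) : Prop :=
  exists inj : forall i, nat_trans (interval_module (bar_of i)) V,
    is_direct_sum (I := B) inj.

Definition empty_barcode : barcode := @Barcode void (fun i => match i with end).

(* The barcode is unique up to reindexing; [empty_barcode] is a dummy value for
   modules that are not interval-decomposable, which does not occur for
   pointwise finite-dimensional ones. *)
Definition barcode_of (V : persistence_module) : barcode :=
  if pselect (exists B, is_barcode_of B V) is left e then projT1 (cid e)
  else empty_barcode.

End Barcode.

Section Bottleneck.
Variable R : realType.
Local Open Scope ereal_scope.

Definition bar_inf (J : bar R) : \bar R := ereal_inf (EFin @` bar_set J).
Definition bar_sup (J : bar R) : \bar R := ereal_sup (EFin @` bar_set J).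

(* No subtraction, so that two infinite endpoints of the same sign are at
   distance 0. *)
Definition within (e : R) (a b : \bar R) : Prop := a <= b + e%:E /\ b <= a + e%:E.

Definition is_matching (e : R) (B C : barcode R) (m : B -> C -> Prop) : Prop :=
  [/\ forall i j j', m i j -> m i j' -> j = j',
      forall i i' j, m i j -> m i' j -> i = i',
      forall i j, m i j -> within e (bar_inf (bar_of i)) (bar_inf (bar_of j)) /\
                           within e (bar_sup (bar_of i)) (bar_sup (bar_of j)),
      forall i, ~ (exists j, m i j) ->
        bar_sup (bar_of i) <= bar_inf (bar_of i) + (2 * e)%:E &
      forall j, ~ (exists i, m i j) ->
        bar_sup (bar_of j) <= bar_inf (bar_of j) + (2 * e)%:E].

Definition bottleneck_distance (B C : barcode R) : \bar R :=
  ereal_inf [set e%:E | e in [set e : R | (0 <= e)%R /\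
    exists m : B -> C -> Prop, is_matching e m]].

End Bottleneck.

Section Config.
Variables (R : realType) (M : metricType R) (n : nat).

Definition homeomorphism (h : M -> M) : Prop :=
  continuous h /\ exists k : M -> M, [/\ continuous k, cancel h k & cancel k h].

Definition isometry (h : M -> M) : Prop :=
  bijective h /\ forall x y, mdist (h x) (h y) = mdist x y.

Definition config := {X : {fset M} | #|` X| == n}.

Definition points (X : config) : {fset M} := val X.

Record config_hom (X Y : config) := ConfigHom {
  chom :> points X -> points Y;
  chom_inv : points Y -> points X;
  chomK : cancel chom chom_inv;
  chom_invK : cancel chom_inv chom;
  chom_ext : exists h : M -> M,
    [/\ homeomorphism h, h @` [set` points X] = [set` points Y] &
        forall x : points X, h (val x) = val (chom x)] }.

Lemma config_hom_eq (X Y : config) (f g : config_hom X Y) :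
  (forall x, f x = g x) -> f = g.
Proof.
case: f g => f f' fK f'K fe [g g' gK g'K ge] /= /funext fg; subst g.
have E : f' = g' by apply/funext => y; rewrite -[y in LHS]g'K fK.
by subst g'; congr ConfigHom; exact: Prop_irrelevance.
Qed.

Definition config_id (X : config) : config_hom X X.
Proof.
exists id id => //; exists id; split => //; last by rewrite image_id.
by split=> [x|]; [exact: cvg_id|exists id; split => // x; exact: cvg_id].
Defined.

Definition config_comp (X Y Z : config) (g : config_hom Y Z)
  (f : config_hom X Y) : config_hom X Z.
Proof.
exists (g \o f) (chom_inv f \o chom_inv g).
- by apply: can_comp; exact: chomK.
- by apply: can_comp; exact: chom_invK.
- have [h [[ch [h' [ch' hK h'K]]] hX hf]] := chom_ext f.
  have [k [[ck [k' [ck' kK k'K]]] kY kg]] := chom_ext g.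
  exists (k \o h); split; last by move=> x /=; rewrite hf kg.
  + split; first by move=> x; apply: continuous_comp; [exact: ch|exact: ck].
    exists (h' \o k'); split; [|exact: can_comp kK hK|exact: can_comp h'K k'K].
    by move=> x; apply: continuous_comp; [exact: ck'|exact: ch'].
  + by rewrite -image_comp hX kY.
Defined.

Definition Sn : category.
Proof.
by exists config config_hom config_id config_comp => *; exact: config_hom_eq.
Defined.

Definition persistence_config := functor (real_poset R) Sn.

Definition Sym (X : config) : {set {perm points X}} :=
  finset (fun p : {perm points X} => `[< exists h : M -> M,
    [/\ isometry h, h @` [set` points X] = [set` points X] &
        forall x : points X, h (val x) = val (p x)] >]).

Lemma conj_inj (X Y : config) (f : config_hom X Y) (p : {perm points X}) :
  injective (fun y => f (p (chom_inv f y))).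
Proof.
apply: (inj_comp (can_inj (chomK f))).
by apply: inj_comp; [exact: perm_inj|exact: can_inj (chom_invK f)].
Qed.

Definition conjugate (X Y : config) (f : config_hom X Y) (p : {perm points X}) :
  {perm points Y} := perm (@conj_inj X Y f p).

Lemma conjugate_comp (X Y Z : config) (g : config_hom Y Z) (f : config_hom X Y)
    (p : {perm points X}) :
  conjugate (config_comp g f) p = conjugate g (conjugate f p).
Proof. by apply/permP => y; rewrite !permE. Qed.

Lemma conjugate_id (X : config) (f : config_hom X X) (p : {perm points X}) :
  (forall x, val (f x) = val x) -> conjugate f p = p.
Proof.
move=> fE; have {}fE x : f x = x by exact: val_inj.
by apply/permP => x; rewrite permE fE -[X in p X = _]fE chom_invK.
Qed.

Lemma Sym_conjugate_id (X Y : config) (f : config_hom X Y)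
    (p : {perm points X}) :
  (forall x, val (f x) = val x) -> (conjugate f p \in Sym Y) = (p \in Sym X).
Proof.
move=> fE; have XY : X = Y.
  apply: val_inj; apply/fsetP => z; apply/idP/idP => [zX|zY].
    by rewrite -[z]/(val [` zX]%fset) -fE; exact: valP.
  rewrite -[z]/(val [` zY]%fset) -[[` zY]%fset](chom_invK f) fE; exact: valP.
by subst Y; rewrite conjugate_id.
Qed.

Record dyn_obj := DynObj {
  dyn_cfg :> functor (real_poset R) Sn;
  dyn_end : R;
  dyn_const : forall t : R, dyn_end <= t -> dyn_cfg t = dyn_cfg dyn_end }.


(* A morphism (F,r) -> (G,s) is the natural transformation with the prescribed
   components; equality of points of two configurations is equality in M.
   Naturality forces the structure maps of F and G to agree below r. *)
Record dyn_hom (A B : dyn_obj) := DynHom {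
  dyn_nat :> nat_trans A B;
  dyn_le : dyn_end A <= dyn_end B;
  dyn_eq : forall t : R, t <= dyn_end A -> A t = B t;
  dyn_low : forall t : R, t <= dyn_end A ->
    forall x : points (A t), val (dyn_nat t x) = val x;
  dyn_mid : forall (t : R) (rt : dyn_end A <= t),
    dyn_end A < t -> t <= dyn_end B ->
    forall (x : points (A t)) (y : points (B (dyn_end A))), val x = val y ->
      val (dyn_nat t x) = val (fmap B (rle rt) y);
  dyn_high : forall t : R, dyn_end B < t ->
    forall (x : points (A t)) (y : points (B (dyn_end A))), val x = val y ->
      val (dyn_nat t x) = val (fmap B (rle dyn_le) y) }.

Lemma dyn_hom_eq (A B : dyn_obj) (f g : dyn_hom A B) :
  (forall t (x : points (A t)), f t x = g t x) -> f = g.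
Proof.
case: f g => f f1 f2 f3 f4 f5 [g g1 g2 g3 g4 g5] /= fg.
have E : f = g by apply: nat_trans_eq => t; apply: config_hom_eq => x; exact: fg.
subst g; have E1 : f1 = g1 by exact: bool_irrelevance.
by subst g1; congr DynHom; exact: Prop_irrelevance.
Qed.

Definition dyn_id (A : dyn_obj) : dyn_hom A A.
Proof.
exists (nat_id A) (lexx (dyn_end A)) => //= [t rt rt' tr|t rt x y xy].
  by have := lt_le_trans rt' tr; rewrite ltxx.
rewrite xy (_ : rle _ = idm (dyn_end A : real_poset R)) ?fmap1 //.
Defined.

Lemma fmap_comp (C : category) (F : functor (real_poset R) C) (s t u : R)
    (st : s <= t) (tu : t <= u) (su : s <= u) :
  comp (fmap F (rle tu)) (fmap F (rle st)) = fmap F (rle su).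
Proof. by rewrite -fmapM; congr (fmap F _); exact: bool_irrelevance. Qed.

Lemma dyn_fmap (A B : dyn_obj) (f : dyn_hom A B) (s t : R) (st : s <= t) :
  t <= dyn_end A -> forall (x : points (A s)) (y : points (B s)),
  val x = val y -> val (fmap A (rle st) x) = val (fmap B (rle st) y).
Proof.
move=> tr x y xy; rewrite -(dyn_low f tr).
have /(congr1 (fun h : config_hom _ _ => h x)) /= -> := naturality f (rle st).
by congr val; congr (fmap B _ _); apply: val_inj; rewrite (dyn_low f) // (le_trans st).
Qed.

Lemma dyn_pull (A B : dyn_obj) (f : dyn_hom A B) (t : R) (y : points (B t)) :
  t <= dyn_end A -> exists x : points (A t), val x = val y.
Proof. by move=> /(dyn_eq f) E; move: y; rewrite -E => y; exists y. Qed.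

Lemma dyn_step (A B C : dyn_obj) (g : dyn_hom B C) (f : dyn_hom A B) (t : R)
    (x : points (A t)) (y : points (C (dyn_end A))) : dyn_end B < t ->
  val x = val y -> val (f t x) = val (fmap C (rle (dyn_le f)) y).
Proof.
move=> st xy; have [y' y'y] := dyn_pull g y (dyn_le f).
by rewrite -(dyn_fmap g _ (lexx _) y'y) (dyn_high f st (etrans xy (esym y'y))).
Qed.

Definition dyn_comp (A B C : dyn_obj) (g : dyn_hom B C) (f : dyn_hom A B) :
  dyn_hom A C.
Proof.
exists (nat_comp g f) (le_trans (dyn_le f) (dyn_le g)).
- by move=> t tr; rewrite (dyn_eq f tr) (dyn_eq g) // (le_trans tr) ?dyn_le.
- by move=> t tr x /=; rewrite (dyn_low g) ?(dyn_low f) // (le_trans tr) ?dyn_le.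
- move=> t rt rt' tu x y xy /=.
  have [ts|st] := leP t (dyn_end B).
    have [y' y'y] := dyn_pull g y (dyn_le f).
    rewrite (dyn_low g ts) (dyn_mid f rt rt' ts (etrans xy (esym y'y))).
    exact: (dyn_fmap g rt ts y'y).
  rewrite (dyn_mid g (ltW st) st tu (dyn_step g f st xy)).
  by rewrite -(fmap_comp C (dyn_le f) (ltW st) rt).
- move=> t ut x y xy /=; have st := le_lt_trans (dyn_le g) ut.
  rewrite (dyn_high g ut (dyn_step g f st xy)).
  by rewrite -(fmap_comp C (dyn_le f) (dyn_le g) (le_trans _ _)).
Defined.

Definition Dyn : category.
Proof.
by exists dyn_obj dyn_hom dyn_id dyn_comp => *; apply: dyn_hom_eq.
Defined.

Definition persistence_dynamical_system := functor (real_poset R) Dyn.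

End Config.

Section SymmetryFunctor.
Variables (R : realType) (M : metricType R) (n : nat) (K : fieldType).

(* g_{r,u}, precomposed with the identity F_r -> G_r. *)
Definition dyn_map (A B : dyn_obj M n) (f : dyn_hom A B) (u : R)
    (ru : dyn_end A <= u) : config_hom (A (dyn_end A)) (B u) :=
  config_comp (fmap B (rle ru)) (f (dyn_end A)).

(* Membership in L_{r,s}: the decomposition r = t_0 < ... < t_k = s is the
   sequence [dyn_end A :: ts]. *)
Definition sym_lift (A B : dyn_obj M n) (f : dyn_hom A B)
    (p : {perm points (A (dyn_end A))}) : Prop :=
  p \in Sym (A (dyn_end A)) /\
  forall ts : seq R, path <%R (dyn_end A) ts ->
    last (dyn_end A) ts = dyn_end B ->
    forall (u : R) (ru : dyn_end A <= u), u \in dyn_end A :: ts ->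
      conjugate (dyn_map f ru) p \in Sym (B u).

Lemma path_le_last (r u : R) (ts : seq R) :
  path <%R r ts -> u \in r :: ts -> r <= u /\ u <= last r ts.
Proof.
elim: ts r u => [|t ts IH] r u /=; first by rewrite mem_seq1 => _ /eqP ->.
move=> /andP[rt tts]; rewrite in_cons => /orP[/eqP ->|uts].
  split=> //; apply: le_trans (ltW rt) _.
  by have [] := IH t t tts (mem_head _ _).
by have [tu uL] := IH t u tts uts; split => //; apply: le_trans (ltW rt) tu.
Qed.

Lemma sym_liftP (A B : dyn_obj M n) (f : dyn_hom A B)
    (p : {perm points (A (dyn_end A))}) :
  sym_lift f p <-> p \in Sym (A (dyn_end A)) /\
    forall (u : R) (ru : dyn_end A <= u), u <= dyn_end B ->
      conjugate (dyn_map f ru) p \in Sym (B u).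
Proof.
split=> -[pS H]; split => //.
  move=> u ru us.
  suff [ts [p1 p2 p3]] : exists ts : seq R, [/\ path <%R (dyn_end A) ts,
      last (dyn_end A) ts = dyn_end B & u \in dyn_end A :: ts] by exact: H p3.
  move: ru us; rewrite le_eqVlt => /orP[/eqP <-|ru].
    rewrite le_eqVlt => /orP[/eqP rs|rs]; first by exists [::]; rewrite mem_head.
    by exists [:: dyn_end B]; rewrite mem_head /= rs.
  rewrite le_eqVlt => /orP[/eqP us|us].
    by exists [:: u]; rewrite mem_seq2 eqxx orbT /= ru us.
  by exists [:: u; dyn_end B]; rewrite !inE eqxx orbT /= ru us.
by move=> ts rts Bts u ru uts; apply: H; rewrite -Bts; have [] := path_le_last rts uts.
Qed.

Definition sym_index (X : config M n) := {p : {perm points X} | p \in Sym X}.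

(* K[Sym(X)], as functions on the finite set Sym(X). *)
Definition sym_space (X : config M n) : lmodType K :=
  {ffun sym_index X -> K^o}.

Definition sym_basis (X : config M n) (p : {perm points X}) : sym_space X :=
  [ffun q => (val q == p)%:R].

Definition sym_map (A B : dyn_obj M n) (f : dyn_hom A B)
    (v : sym_space (A (dyn_end A))) : sym_space (B (dyn_end B)) :=
  \sum_(p : sym_index (A (dyn_end A)))
    if `[< sym_lift f (val p) >]
    then (v : {ffun _ -> K^o}) p *: sym_basis (conjugate (dyn_map f (dyn_le f)) (val p))
    else 0.


Lemma sym_lift_id (A : dyn_obj M n) (p : {perm points (A (dyn_end A))}) :
  p \in Sym (A (dyn_end A)) -> sym_lift (dyn_id A) p.
Proof.
move=> pS; apply/sym_liftP; split => // u ru ur.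
have E : u = dyn_end A by apply/eqP; rewrite eq_le ur ru.
move: ru; rewrite E => ru; rewrite Sym_conjugate_id // => x /=.
by rewrite (_ : rle ru = idm (dyn_end A : real_poset R)) ?fmap1 //; exact: bool_irrelevance.
Qed.

Lemma dyn_map_low (A B C : dyn_obj M n) (g : dyn_hom B C) (f : dyn_hom A B)
    (u : R) (ru : dyn_end A <= u) :
  dyn_map (dyn_comp g f) ru = config_comp (g u) (dyn_map f ru).
Proof.
apply: config_hom_eq => x /=.
by have /(congr1 (fun h : config_hom _ _ => h (f _ x))) /= -> := naturality g (rle ru).
Qed.

Lemma dyn_map_high (A B C : dyn_obj M n) (g : dyn_hom B C) (f : dyn_hom A B)
    (u : R) (su : dyn_end B <= u) (ru : dyn_end A <= u) :
  dyn_map (dyn_comp g f) ru =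
  config_comp (dyn_map g su) (dyn_map f (dyn_le f)).
Proof.
apply: config_hom_eq => x /=.
have /(congr1 (fun h : config_hom _ _ => h (f _ x))) /= -> :=
  naturality g (rle (dyn_le f)).
by rewrite -(fmap_comp C (dyn_le f) su ru).
Qed.

Lemma sym_lift_comp (A B C : dyn_obj M n) (g : dyn_hom B C) (f : dyn_hom A B)
    (p : {perm points (A (dyn_end A))}) :
  sym_lift (dyn_comp g f) p <->
  sym_lift f p /\ sym_lift g (conjugate (dyn_map f (dyn_le f)) p).
Proof.
have rs := dyn_le f; have st := dyn_le g; split.
  move=> /sym_liftP[pS H].
  have Hf : sym_lift f p.
    apply/sym_liftP; split => // u ru us.
    have := H u ru (le_trans us st).
    rewrite dyn_map_low conjugate_comp Sym_conjugate_id // => x.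
    by rewrite (dyn_low g).
  split => //; apply/sym_liftP; split.
    by move/sym_liftP : Hf => [_]; apply.
  move=> u su ut; rewrite -conjugate_comp -dyn_map_high; first exact: le_trans su.
  by move=> ru; exact: H.
move=> [/sym_liftP[pS Hf] /sym_liftP[_ Hg]]; apply/sym_liftP; split => // u ru ut.
have [us|su] := leP u (dyn_end B); last first.
  by rewrite (dyn_map_high g f (ltW su)) conjugate_comp; exact: Hg.
rewrite dyn_map_low conjugate_comp Sym_conjugate_id ?Hf // => x.
by rewrite (dyn_low g).
Qed.


Lemma sym_map_linear (A B : dyn_obj M n) (f : dyn_hom A B) : linear (sym_map f).
Proof.
move=> a v w; rewrite /sym_map scaler_sumr -big_split /=; apply: eq_bigr => p _.
case: ifP => _; last by rewrite scaler0 addr0.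
by rewrite !ffunE scalerDl scalerA.
Qed.

HB.instance Definition _ (A B : dyn_obj M n) (f : dyn_hom A B) :=
  GRing.isLinear.Build K (sym_space (A (dyn_end A))) (sym_space (B (dyn_end B)))
    _ (sym_map f) (sym_map_linear f).

Lemma sym_map_basis (A B : dyn_obj M n) (f : dyn_hom A B)
    (p : {perm points (A (dyn_end A))}) : p \in Sym (A (dyn_end A)) ->
  sym_map f (sym_basis p) = if `[< sym_lift f p >]
    then sym_basis (conjugate (dyn_map f (dyn_le f)) p) else 0.
Proof.
move=> pS; rewrite /sym_map (bigD1 (Sub p pS : sym_index _)) //= big1 ?addr0.
  by rewrite ffunE SubK eqxx scale1r.
move=> q qp; rewrite ffunE (_ : (val q == p) = false) ?scale0r ?if_same //.
by apply: contraNF qp => /eqP qp; apply/eqP/val_inj.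
Qed.

Lemma sym_basis_sum (X : config M n) (v : sym_space X) :
  v = \sum_(p : sym_index X) (v : {ffun _ -> K^o}) p *: sym_basis (val p).
Proof.
apply/ffunP => q; rewrite sum_ffunE (bigD1 q) //= big1 ?addr0.
  by rewrite !ffunE eqxx -[RHS]/(_ * 1) mulr1.
move=> p pq; rewrite !ffunE (_ : (val q == val p) = false) ?scaler0 //.
by apply: contraNF pq => /eqP/val_inj ->.
Qed.

Definition sym_functor : functor (Dyn M n) (Vec K).
Proof.
exists (fun A : dyn_obj M n => sym_space (A (dyn_end A)))
  (fun (A B : dyn_obj M n) (f : dyn_hom A B) => sym_map f : {linear _ -> _}).
- move=> A; apply: linear_eq => /= v; rewrite [RHS]sym_basis_sum; apply: eq_bigr => p _.
  have pS := valP p; rewrite (asboolT (sym_lift_id pS)) conjugate_id // => x /=.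
  rewrite (_ : rle _ = idm (dyn_end A : real_poset R)) ?fmap1 //; exact: bool_irrelevance.
- move=> A B C g f; apply: linear_eq => /= v.
  transitivity (sym_map g (sym_map f v)); last by [].
  rewrite [X in _ = sym_map g X]/sym_map (linear_sum (sym_map g)).
  apply: eq_bigr => p _.
  have [Hf|nHf] := pselect (sym_lift f (val p)); last first.
    by rewrite (asboolF nHf) linear0 asboolF // => /sym_lift_comp[].
  rewrite (asboolT Hf) linearZ /= sym_map_basis; last first.
    by move/sym_liftP: Hf => [_ Hf]; apply: Hf.
  have [Hg|nHg] :=
      pselect (sym_lift g (conjugate (dyn_map f (dyn_le f)) (val p))).
    have Hgf : sym_lift (dyn_comp g f) (val p) by apply/sym_lift_comp.
    rewrite (asboolT Hg) (asboolT Hgf) -conjugate_comp.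
    by rewrite -(dyn_map_high g f (dyn_le g) (dyn_le (dyn_comp g f))).
  by rewrite (asboolF nHg) scaler0 asboolF // => /sym_lift_comp[].
Defined.

Definition SymB (P : persistence_dynamical_system M n) : barcode R :=
  barcode_of (functor_comp sym_functor P).

End SymmetryFunctor.
Arguments SymB {R M n} K P.

(* Main.v *)
Require Import Defs.
From HB Require Import structures.
From mathcomp Require Import all_boot all_order all_algebra all_fingroup finmap.
From mathcomp Require Import all_classical all_reals all_analysis.

(** Conjugation along a morphism of dynamical systems is injective on
permutations, so the induced linear map sends every basis vector of
[K[Sym(X)]] either to 0 or to a basis vector, and never sends two of them to
the same basis vector. This holds for the structure maps of the two symmetry
modules and, since [sym_functor] is a functor, for the maps induced by an
interleaving in [Dyn]. Stability thereby becomes combinatorics of partial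
injections between finite sets.

A persistence module whose structure maps match basis vectors in this way
([matched_basis]) is interval-decomposable: say that a basis vector at time s
flows to a basis vector at time t if the structure map sends the first to the
second. Identifying vectors along the flow gives an equivalence relation, each
class meets a given time in at most one vector, and the times that it meets form
an interval. The classes are the bars ([canonical_is_barcode]).

Suppose that maps u and v of this kind interleave two such modules with
parameter e. Declare a class c linked to a class d by u if u sends a vector of c
to a vector of d, and match c with d if u links c to d and v links d to c.
Naturality and injectivity make links functional and injective
([link_functional], [link_injective]), and a link from c to d bounds both
endpoints of d by those of c plus e ([link_inf], [link_sup]); the two opposite
links give the two bounds that a matching requires. A class alive at t and at
t + 2e is matched, because the composite of u and v is the structure map, which
does not kill its vector ([link_long]). So unmatched bars have length at most
2e.

The symmetry barcode is an arbitrarily chosen barcode of the symmetry module,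
so it must still be compared with the canonical one ([barcode_unique]). In any
barcode, the number of bars containing s and t is the rank of the structure map
from s to t. When finitely many bars meet each time, the bars containing a given
interval J are the bars through two suitable points of J, hence their number
depends on the module alone, and these numbers determine the multiplicity of
every interval, starting with the maximal ones ([perm_eq_count_up]). *)

Set Implicit Arguments.
Unset Strict Implicit.
Unset Printing Implicit Defensive.

Import Order.TTheory GRing.Theory Num.Theory.

Local Open Scope classical_set_scope.
Local Open Scope ring_scope.

(** * Counting independent vectors *)

(** Steinitz bound in a space of any dimension: the coefficient matrix of the
x i over the y j has independent rows. *)
Lemma card_free_le_span (K : fieldType) (U : lmodType K) (I J : choiceType)
    (A : {fset I}) (C : {fset J}) (x : I -> U) (y : J -> U) :
  (forall c : I -> K, \sum_(i <- A) c i *: x i = 0 ->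
     forall i, i \in A -> c i = 0) ->
  (forall i, i \in A -> exists a : J -> K, x i = \sum_(j <- C) a j *: y j) ->
  (#|` A| <= #|` C|)%N.
Proof.
move=> xfree xspan.
have /choice[a xE] : forall i, exists a : J -> K,
    i \in A -> x i = \sum_(j <- C) a j *: y j.
  move=> i; have [iA|niA] := boolP (i \in A); last by exists (fun=> 0).
  by have [a ?] := xspan i iA; exists a.
pose X := \matrix_(k < size A, l < size C)
  a (tnth (in_tuple A) k) (tnth (in_tuple C) l).
suff /eqP <- : row_free X by exact: rank_leq_col.
rewrite -kermx_eq0; apply/eqP/row_matrixP => r.
set v := row r _; have vX : v *m X = 0.
  by rewrite -row_mul mulmx_ker row0.
rewrite row0; apply/rowP => k; rewrite [RHS]mxE.
(* The coefficients of v, reindexed by the members of A. *)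
pose c i := \sum_(k < size A | tnth (in_tuple A) k == i) v 0 k.
have cE l : c (tnth (in_tuple A) l) = v 0 l.
  rewrite /c (eq_bigl (pred1 l)) ?big_pred1_eq // => k' /=.
  by apply/eqP/eqP => [|-> //]; apply/tuple_uniqP; exact: fset_uniq.
rewrite -cE; apply: xfree; last exact: mem_tnth.
transitivity (\sum_(l < size C) (v *m X) 0 l *: y (tnth (in_tuple C) l)).
  rewrite big_tnth.
  under eq_bigr => l _ do rewrite cE xE ?mem_tnth // big_tnth scaler_sumr.
  rewrite exchange_big /=; apply: eq_bigr => l _.
  rewrite mxE scaler_suml; apply: eq_bigr => l' _.
  by rewrite scalerA [X _ _]mxE.
by rewrite vX big1 // => l _; rewrite mxE scale0r.
Qed.

(** * Multisets in a partial order *)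

Lemma exists_maximal (T : eqType) (r : rel T) (b : seq T) :
  reflexive r -> transitive r -> b != [::] ->
  exists2 x, x \in b & forall y, y \in b -> r x y -> r y x.
Proof.
move=> rr tr b0.
case: b b0 => // x0 b' _; set b := x0 :: b'.
pose F (i : 'I_(size b)) := count (r (tnth (in_tuple b) i)) b.
case: (@arg_minnP _ ord0 predT F) => // i _ imin.
exists (tnth (in_tuple b) i); first exact: mem_tnth.
(* An element strictly above x would have fewer elements of b above it. *)
move=> y yb xy; have [j yE] : exists j, y = tnth (in_tuple b) j by apply/tnthP.
have := imin j isT; rewrite yE in xy *; apply: contraLR => nyx.
rewrite -ltnNge /F.
set x := tnth _ i in xy nyx *; set z := tnth _ j in xy nyx *.
have -> : count (r z) b = count (r z) [seq w <- b | r x w].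
  rewrite count_filter; apply: eq_count => w /=.
  by apply/idP/andP => [zw|[]//]; split=> //; exact: tr zw.
rewrite -[ltnRHS]size_filter ltn_neqAle count_size andbT -all_count.
apply/allPn; exists x => //; rewrite mem_filter rr; exact: mem_tnth.
Qed.

(** Up-set counts determine a multiset: an element x maximal in b has something
of c above it, which in turn has something of b above it, so by maximality x
itself occurs in c; remove x from both and continue. *)
Lemma perm_eq_count_up (T : eqType) (r : rel T) (b c : seq T) :
  reflexive r -> antisymmetric r -> transitive r ->
  (forall x, x \in b ++ c -> count (r x) b = count (r x) c) -> perm_eq b c.
Proof.
move=> rr ar tr; have [k] := ubnP (size b).
elim: k b c => // k IH b c /ltnSE bk H.
have [b0|b0] := eqVneq b [::].
  rewrite b0 in H *; case: c H => // y c /(_ y).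
  by rewrite /= mem_head rr => /(_ isT).
have [x xb xmax] := exists_maximal rr tr b0.
have up s z w : z \in s -> r w z -> (0 < count (r w) s)%N.
  by move=> zs wz; rewrite -has_count; apply/hasP; exists z.
have xc : x \in c.
  have : (0 < count (r x) c)%N by rewrite -H ?mem_cat ?xb // (up _ x).
  rewrite -has_count => /hasP[y yc xy].
  have : (0 < count (r y) b)%N by rewrite H ?mem_cat ?yc ?orbT // (up _ y).
  rewrite -has_count => /hasP[z zb yz].
  have zx := xmax z zb (tr _ _ _ xy yz).
  by have <- : y = x by apply: ar; rewrite xy (tr _ _ _ yz zx).
rewrite (perm_trans (perm_to_rem xb)) // perm_sym.
rewrite (perm_trans (perm_to_rem xc)) //.
rewrite perm_cons perm_sym IH //.
  by rewrite size_rem //; case: (b) bk b0.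
move=> y; rewrite mem_cat => yy.
have := H y; have /seq.permP -> := perm_to_rem xb.
have /seq.permP -> := perm_to_rem xc.
move=> /= /(_ _)/addnI; apply.
by rewrite mem_cat; case/orP: yy => /mem_rem ->; rewrite ?orbT.
Qed.

(** * Generators of a barcode *)

Section BoolRow.
Variable K : fieldType.

(** The fibre of an interval module is ['rV_b] with b a boolean, so it is
spanned by the constant row 1 whether it is a line or zero. *)
Lemma row_boolE (b : bool) (w : 'rV[K]_b) :
  w = (\sum_k w 0 k) *: const_mx 1.
Proof.
case: b w => w; apply/rowP => k; last by case: k.
by rewrite !mxE big_ord1 mulr1 (ord1 k).
Qed.

Lemma const_row_bool_pid (b b' : bool) :
  (const_mx 1 : 'rV[K]_b) *m pid_mx 1 =
  (b && b')%:R *: (const_mx 1 : 'rV[K]_b').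
Proof.
apply/rowP; case: b; case: b' => k //=; try by case: k.
  by rewrite pid_mx_1 mulmx1 !mxE mulr1.
by rewrite !mxE big_ord0 mul0r.
Qed.

End BoolRow.

Section PersistenceModule.
Variables (R : realType) (K : fieldType).
Implicit Types V W : persistence_module R K.

Definition structure_map V (s t : R) (st : s <= t) :
    {linear (V s : lmodType K) -> (V t : lmodType K)} :=
  Defs.fmap V (rle st).

Lemma structure_map_id V (s : R) (ss : s <= s) v : structure_map V ss v = v.
Proof.
rewrite /structure_map (_ : rle ss = Defs.idm (s : real_poset R)) ?fmap1 //.
exact: bool_irrelevance.
Qed.

Lemma structure_map_comp V (s t u : R) (st : s <= t) (tu : t <= u)
    (su : s <= u) v :
  structure_map V tu (structure_map V st v) = structure_map V su v.
Proof. by rewrite /structure_map -(Defs.fmap_comp V st tu su). Qed.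

Definition bars_through (B : barcode R) (s t : R) : set B :=
  [set i | bar_set (bar_of i) s /\ bar_set (bar_of i) t].

Definition locally_finite (B : barcode R) : Prop :=
  forall t : R, finite_set [set i : B | bar_set (bar_of i) t].

Section Generator.
Variables (V : persistence_module R K) (B : barcode R).
Variable inj : forall i : B, nat_trans (interval_module K (bar_of i)) V.

Definition generator (t : R) (i : B) : (V t : lmodType K) :=
  (inj i t : {linear 'rV[K]_(t \in bar_set (bar_of i)) -> (V t : lmodType K)})
    (const_mx 1).

Lemma inj_generator (t : R) (i : B) (w : 'rV[K]_(t \in bar_set (bar_of i))) :
  (inj i t : {linear _ -> _}) w = (\sum_k w 0 k) *: generator t i.
Proof. by rewrite [w in LHS]row_boolE linearZ. Qed.

Lemma generator_out (t : R) (i : B) :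
  ~ bar_set (bar_of i) t -> generator t i = 0.
Proof.
rewrite /generator => nt.
have tF : (t \in bar_set (bar_of i)) = false by apply/negP => /set_mem.
rewrite (_ : const_mx 1 = 0) ?linear0 //.
by apply/rowP => -[k kt]; exfalso; rewrite tF in kt.
Qed.

Lemma structure_map_generator (s t : R) (st : s <= t) (i : B) :
  bar_set (bar_of i) s -> structure_map V st (generator s i) = generator t i.
Proof.
move=> /mem_set si.
have <- : (inj i t : {linear _ -> _}) (const_mx 1 *m
    (pid_mx 1 : 'M[K]_(s \in bar_set (bar_of i), t \in bar_set (bar_of i)))) =
    structure_map V st (generator s i).
  have := congr1 (fun f : {linear 'rV[K]_(s \in bar_set (bar_of i)) ->
    (V t : lmodType K)} => f (const_mx 1)) (naturality (inj i) (rle st)).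
  by move=> /= H; exact: H.
rewrite const_row_bool_pid si /= linearZ /=.
rewrite -/(generator t i).
have [_|/negP nt] := boolP (t \in bar_set (bar_of i)); first by rewrite scale1r.
by rewrite generator_out ?scaler0 // => /mem_set.
Qed.

Hypothesis dsum : is_direct_sum inj.

(** Both a linear relation and the zero relation decompose the vector 0, so the
uniqueness part of the direct sum identifies them. *)
Lemma generator_free (t : R) (A : {fset B}) (c : B -> K) :
  (forall i, i \in A -> bar_set (bar_of i) t) ->
  \sum_(i <- A) c i *: generator t i = 0 -> forall i, i \in A -> c i = 0.
Proof.
move=> At c0 i iA.
pose w j : 'rV[K]_(t \in bar_set (bar_of j)) :=
  const_mx (if j \in A then c j else 0).
have [w0 [_ w0_uniq]] := dsum (0 : (V t : lmodType K)).
have E : w = fun=> 0.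
  transitivity w0; last first.
    apply: w0_uniq; split.
      by rewrite (_ : [set _ | _] = set0) //; apply/seteqP; split => j //= /eqP.
    by rewrite fsbig1 // => j _; rewrite linear0.
  apply/esym/w0_uniq; split.
    apply: (sub_finite_set _ (finite_fset A)) => j /=.
    apply: contra_neqT => jA; rewrite /w (negPf jA); apply/rowP => k.
    by rewrite !mxE.
  rewrite (fsbigTE A); last first.
    move=> j jA; rewrite inj_generator big1 ?scale0r // => k _.
    by rewrite mxE (negPf jA).
  rewrite -[LHS]c0; apply: eq_big_seq => j jA; rewrite inj_generator.
  congr (_ *: _); have := mem_set (At _ jA).
  rewrite /w jA; case: (_ \in _) => // _.
  by rewrite big_ord1 mxE.
have it := mem_set (At _ iA).
have := congr1 (fun w => w i) E; rewrite /= /w iA.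
move: it; case: (_ \in _) => // _ /rowP/(_ ord0).
by rewrite !mxE.
Qed.

(** The structure map kills the generators of the bars that contain s but not
t, and moves the other ones along their bars. *)
Lemma generator_span (s t : R) (st : s <= t) (A : {fset B})
    (v : (V s : lmodType K)) :
  (forall i, bars_through s t i -> i \in A) ->
  exists c : B -> K,
    structure_map V st v = \sum_(i <- A) c i *: generator t i.
Proof.
move=> Ast; have [w [[wfin ->] _]] := dsum v.
pose a (i : B) : K := \sum_k w i 0 k.
pose c (i : B) := if s \in bar_set (bar_of i) then a i else 0.
exists c.
have [F FE] : exists F : {fset B}, [set i | w i != 0] `<=` [set` F].
  by exists (fset_set [set i | w i != 0]); rewrite fset_setK.
rewrite (fsbigTE (A `|` F)%fset); last first.
  move=> i; rewrite inE negb_or => /andP[_ iF].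
  suff /eqP -> : w i == 0 by rewrite linear0.
  by apply: contraNT iF; apply: FE.
rewrite linear_sum /=.
under eq_bigr => i _ do rewrite inj_generator -/(a i) linearZ /=.
rewrite (eq_bigr (fun i => c i *: generator t i)); last first.
  move=> i _; rewrite /c.
  have [/set_mem si|/negP nsi] := boolP (s \in bar_set (bar_of i)).
    by rewrite structure_map_generator.
  rewrite (@generator_out s) ?linear0 ?scaler0 ?scale0r // => si.
  by apply: nsi; exact: mem_set.
apply/esym/big_fset_incl => [|i iAF iA]; first exact: fsubsetUl.
rewrite /c; have [/set_mem si|_] := boolP (s \in _); last by rewrite scale0r.
rewrite generator_out ?scaler0 // => ti.
by move/negP : iA; apply; apply: Ast.
Qed.

End Generator.

(** The generators at t of the bars through s and t form a basis of the image of
the structure map, so their number is its rank; this is the inequality between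
the counts of two barcodes, from which both finiteness and equality follow. *)
Lemma card_bars_through_le V (B C : barcode R) (s t : R) (st : s <= t)
    (A : {fset B}) (D : {fset C}) :
  is_barcode_of B V -> is_barcode_of C V ->
  (forall i, i \in A -> bars_through s t i) ->
  (forall j, bars_through s t j -> j \in D) ->
  (#|` A| <= #|` D|)%N.
Proof.
move=> [injB dB] [injC dC] Ast Dst.
apply: (card_free_le_span (x := generator injB t) (y := generator injC t)).
  by move=> c; apply: (generator_free dB) => i /Ast[].
move=> i iA.
rewrite -(structure_map_generator injB st); last by have [] := Ast i iA.
exact: (generator_span dC).
Qed.

Lemma finite_bars_through (B : barcode R) (s t : R) :
  locally_finite B -> finite_set (bars_through (B := B) s t).
Proof. by move=> /(_ s); apply: sub_finite_set => i []. Qed.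

Lemma barcode_locally_finite V (B C : barcode R) :
  is_barcode_of B V -> is_barcode_of C V ->
  locally_finite C -> locally_finite B.
Proof.
move=> BV CV Cfin t; apply: contrapT => Binf.
pose k := #|` fset_set [set j : C | bar_set (bar_of j) t]|.
have [A AB] := infinite_set_fset k.+1 Binf.
apply/negP; rewrite -leqNgt.
apply: (card_bars_through_le (lexx t) BV CV) => [i /AB //|j [jt _]].
by rewrite in_fset_set ?inE.
Qed.

Lemma card_bars_through V (B C : barcode R) (s t : R) :
  is_barcode_of B V -> is_barcode_of C V ->
  locally_finite B -> locally_finite C -> s <= t ->
  #|` fset_set (bars_through (B := B) s t)| =
  #|` fset_set (bars_through (B := C) s t)|.
Proof.
move=> BV CV Bfin Cfin st; apply/eqP; rewrite eqn_leq; apply/andP; split.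
  apply: (card_bars_through_le st BV CV) => i; rewrite in_fset_set ?inE //;
  exact: finite_bars_through.
apply: (card_bars_through_le st CV BV) => i; rewrite in_fset_set ?inE //;
exact: finite_bars_through.
Qed.

End PersistenceModule.

(** * Uniqueness of barcodes *)

Lemma seq_bounds (R : realType) (t : R) (P : seq R) :
  exists s u, [/\ s \in t :: P, u \in t :: P &
    forall p, p \in t :: P -> s <= p /\ p <= u].
Proof.
elim: P t => [|q P IH] t.
  by exists t, t; rewrite mem_head; split=> // p; rewrite inE => /eqP ->.
have [s [u [sP uP su]]] := IH q.
exists (Num.min t s), (Num.max t u); split.
- by rewrite minEle; case: ifP => _; rewrite in_cons ?eqxx ?sP ?orbT.
- by rewrite maxEle; case: ifP => _; rewrite in_cons ?eqxx ?uP ?orbT.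
move=> p; rewrite in_cons ge_min le_max => /orP[/eqP ->|/su[-> ->]].
  by rewrite lexx.
by rewrite !orbT.
Qed.

Lemma count_fset_set (T : choiceType) (X : set T) (p : pred T) :
  finite_set X ->
  count p (fset_set X) = #|` fset_set [set x | X x /\ p x]|.
Proof.
move=> Xfin; rewrite -size_filter; apply/perm_size/uniq_perm.
- by rewrite filter_uniq.
- exact: fset_uniq.
move=> x; rewrite mem_filter !in_fset_set //; last first.
  by apply: sub_finite_set Xfin => y [].
by apply/andP/idP; rewrite !inE => -[].
Qed.

Section Uniqueness.
Variables (R : realType) (K : fieldType).
Implicit Types (V : persistence_module R K) (B C : barcode R).

(** Each of the finitely many bars at t that fail to contain J misses some point
of J; P collects one such point for each of them. *)
Lemma finite_separator B (J : set R) (t : R) :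
  locally_finite B -> J t ->
  exists P : seq R, (forall p, p \in t :: P -> J p) /\
    forall i : B, (forall p, p \in t :: P -> bar_set (bar_of i) p) ->
      J `<=` bar_set (bar_of i).
Proof.
move=> Bfin Jt.
have /choice[p pP] (i : B) : exists p,
    J p /\ (bar_set (bar_of i) p -> J `<=` bar_set (bar_of i)).
  have [Ji|] := pselect (J `<=` bar_set (bar_of i)); first by exists t.
  by move=> /existsNP[p /not_implyP[Jp np]]; exists p; split.
exists [seq p i | i <- fset_set [set i : B | bar_set (bar_of i) t]]; split.
  by move=> q; rewrite in_cons => /orP[/eqP -> //|/mapP[i _ ->]]; case: (pP i).
move=> i iP; have [_] := pP i; apply; apply: (iP).
rewrite in_cons map_f ?orbT // in_fset_set ?inE //.
by apply: iP; exact: mem_head.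
Qed.

(** A bar is convex, so it contains J as soon as it contains the least and the
greatest of the separating points of both barcodes: the bars containing J are
the bars through these two points. *)
Lemma card_bars_above V B C (J : bar R) :
  is_barcode_of B V -> is_barcode_of C V ->
  locally_finite B -> locally_finite C ->
  #|` fset_set [set i : B | bar_set J `<=` bar_set (bar_of i)]| =
  #|` fset_set [set i : C | bar_set J `<=` bar_set (bar_of i)]|.
Proof.
move=> BV CV Bfin Cfin; have [t Jt] := bar_nonempty J.
have [P [PJ PB]] := finite_separator Bfin Jt.
have [Q [QJ QC]] := finite_separator Cfin Jt.
have [s [u [sPQ uPQ su]]] := seq_bounds t (P ++ Q).
have PQJ p : p \in t :: P ++ Q -> bar_set J p.
  rewrite in_cons mem_cat orbA => /orP[|pQ]; first by rewrite -in_cons => /PJ.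
  by apply: QJ; rewrite in_cons pQ orbT.
have lesu : s <= u by have [] := su t (mem_head _ _); exact: le_trans.
have aboveE (D : barcode R) (S : seq R) : {subset S <= P ++ Q} ->
    (forall i : D, (forall p, p \in t :: S -> bar_set (bar_of i) p) ->
      bar_set J `<=` bar_set (bar_of i)) ->
    [set i : D | bar_set J `<=` bar_set (bar_of i)] = bars_through (B := D) s u.
  move=> SPQ DS; apply/seteqP; split => i.
    by move=> Ji; split; apply: Ji; apply: PQJ.
  move=> [si ui]; apply: DS => p pS; apply: (bar_interval si ui).
  apply/andP/su; move: pS; rewrite !in_cons => /orP[-> //|/SPQ ->].
  by rewrite orbT.
rewrite (aboveE B P) //; last by move=> p; rewrite mem_cat => ->.
rewrite (aboveE C Q) //; last by move=> p; rewrite mem_cat => ->; rewrite orbT.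
exact: card_bars_through BV CV Bfin Cfin lesu.
Qed.

Lemma finite_multiplicity B (J : bar R) : locally_finite B ->
  finite_set [set i : B | bar_set (bar_of i) = bar_set J].
Proof.
move=> Bfin; have [t Jt] := bar_nonempty J.
by apply: sub_finite_set (Bfin t) => i /= ->.
Qed.

(** Bars equal to J pass through a point t of J, so only the finite multisets of
bars at t matter. There, the numbers of bars above each interval agree, which
forces the multisets to agree. *)
Lemma card_multiplicity V B C (J : bar R) :
  is_barcode_of B V -> is_barcode_of C V ->
  locally_finite B -> locally_finite C ->
  #|` fset_set [set i : B | bar_set (bar_of i) = bar_set J]| =
  #|` fset_set [set i : C | bar_set (bar_of i) = bar_set J]|.
Proof.
move=> BV CV Bfin Cfin; have [t Jt] := bar_nonempty J.
pose at_t (D : barcode R) :=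
  [seq bar_set (bar_of i) | i <- fset_set [set i : D | bar_set (bar_of i) t]].
pose r (x y : set R) := `[< x `<=` y >].
have countE (D : barcode R) (q : pred (set R)) : locally_finite D ->
    (forall x, q x -> x t) ->
    count q (at_t D) = #|` fset_set [set i : D | q (bar_set (bar_of i))]|.
  move=> Dfin qt; rewrite /at_t count_map count_fset_set //.
  congr #|` fset_set _|; apply/seteqP; split=> i /=; first by case.
  by move=> qi; split=> //; apply: qt.
have /seq.permP/(_ (pred1 (bar_set J))) : perm_eq (at_t B) (at_t C).
  apply: (@perm_eq_count_up _ r).
  - by move=> x; apply/asboolP.
  - move=> x y /andP[/asboolP xy /asboolP yx]; exact/seteqP.
  - by move=> y x z /asboolP xy /asboolP yz; apply/asboolP/(subset_trans xy).
  move=> x xBC.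
  have [J' J't ->] : exists2 J' : bar R, bar_set J' t & x = bar_set J'.
    by move: xBC; rewrite mem_cat => /orP[] /mapP[i];
      rewrite in_fset_set ?inE // => it ->; exists (bar_of i).
  have qt y : r (bar_set J') y -> y t by move=> /asboolP; apply.
  rewrite (countE B) // (countE C) //.
  rewrite (_ : [set i : B | _] =
      [set i : B | bar_set J' `<=` bar_set (bar_of i)]).
    rewrite (card_bars_above J' BV CV Bfin Cfin).
    by congr #|` fset_set _|; apply/seteqP; split=> i /asboolP.
  by apply/seteqP; split=> i /asboolP.
have qt y : pred1 (bar_set J) y -> y t by move=> /eqP ->.
rewrite !countE // => E.
transitivity #|` fset_set [set i : B | pred1 (bar_set J) (bar_set (bar_of i))]|.
  by congr #|` fset_set _|; apply/seteqP; split=> i /eqP.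
rewrite E; congr #|` fset_set _|; apply/seteqP; split=> i /eqP //.
Qed.

(** The rank bound makes B locally finite as well. The bijection sends the k-th
copy of an interval in B to its k-th copy in C. *)
Theorem barcode_unique V B C :
  is_barcode_of B V -> is_barcode_of C V -> locally_finite C ->
  exists f : B -> C,
    bijective f /\ forall i, bar_set (bar_of (f i)) = bar_set (bar_of i).
Proof.
move=> BV CV Cfin; have Bfin := barcode_locally_finite BV CV Cfin.
pose copies (D : barcode R) (J : bar R) : {fset D} :=
  fset_set [set i : D | bar_set (bar_of i) = bar_set J].
have copiesE (D : barcode R) J (i : D) : locally_finite D ->
    (i \in copies D J) = (bar_set (bar_of i) == bar_set J).
  move=> Dfin; rewrite in_fset_set; last exact: finite_multiplicity.
  by apply/idP/eqP; rewrite inE.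
have copies_eq (D : barcode R) (J J' : bar R) :
    bar_set J = bar_set J' -> copies D J = copies D J'.
  by rewrite /copies => ->.
have partner (D E : barcode R) : locally_finite D -> locally_finite E ->
    (forall J, #|` copies D J| = #|` copies E J|) ->
    exists f : D -> E, forall i, bar_set (bar_of (f i)) = bar_set (bar_of i) /\
      index (f i) (copies E (bar_of i)) = index i (copies D (bar_of i)).
  move=> Dfin Efin DE.
  suff /choice[f fP] : forall i : D, exists j : E,
      bar_set (bar_of j) = bar_set (bar_of i) /\
      index j (copies E (bar_of i)) = index i (copies D (bar_of i)) by exists f.
  move=> i.
  have : (index i (copies D (bar_of i)) < #|` copies E (bar_of i)|)%N.
    by rewrite -DE index_mem copiesE.
  case E0 : (copies E (bar_of i) : seq E) => [//|j0 s] lti; rewrite -E0 in lti.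
  exists (nth j0 (copies E (bar_of i)) (index i (copies D (bar_of i)))).
  rewrite -E0 index_uniq //; split=> //.
  by apply/eqP; rewrite -copiesE //; exact: mem_nth.
have [|f fP] := partner B C Bfin Cfin.
  by move=> J; exact: card_multiplicity BV CV _ _.
have [|g gP] := partner C B Cfin Bfin.
  by move=> J; exact: card_multiplicity CV BV _ _.
exists f; split; last by move=> i; have [] := fP i.
have cancelP (D E : barcode R) (h : D -> E) (k : E -> D) : locally_finite D ->
    (forall i, bar_set (bar_of (h i)) = bar_set (bar_of i) /\
      index (h i) (copies E (bar_of i)) = index i (copies D (bar_of i))) ->
    (forall i, bar_set (bar_of (k i)) = bar_set (bar_of i) /\
      index (k i) (copies D (bar_of i)) = index i (copies E (bar_of i))) ->
    cancel h k.
  move=> Dfin hP kP i; have [hi ih] := hP i; have [ki ik] := kP (h i).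
  rewrite !(copies_eq _ _ _ hi) ih in ik.
  by apply: (index_inj i) ik; rewrite copiesE ?ki ?hi.
by exists g; [exact: cancelP fP gP|exact: cancelP gP fP].
Qed.

End Uniqueness.

(** * Modules with a matched basis *)

Section PartialMatching.
Variable K : fieldType.

Definition is_basis (I : finType) (U : lmodType K) (e : I -> U) : Prop :=
  forall x : U, exists! c : {ffun I -> K}, x = \sum_i c i *: e i.

Definition partial_matching (I J : finType) (U W : lmodType K)
    (e : I -> U) (e' : J -> W) (f : U -> W) : Prop :=
  (forall i, f (e i) = 0 \/ exists j, f (e i) = e' j) /\
  (forall i i' j, f (e i) = e' j -> f (e i') = e' j -> i = i').

Variables (I : finType) (U : lmodType K) (e : I -> U).
Hypothesis e_basis : is_basis e.

Lemma basis_coef_eq (c d : I -> K) :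
  \sum_i c i *: e i = \sum_i d i *: e i -> c =1 d.
Proof.
move=> cd i; have [c0 [_ uniq]] := e_basis (\sum_i c i *: e i).
have ffun_sum (a : I -> K) : \sum_i a i *: e i = \sum_i finfun a i *: e i.
  by apply: eq_bigr => j _; rewrite ffunE.
have := uniq (finfun d); rewrite -ffun_sum => /(_ cd) c0d.
have := uniq (finfun c) (ffun_sum c); rewrite c0d => /ffunP/(_ i).
by rewrite !ffunE.
Qed.

Lemma basis_elt (i : I) : \sum_j (j == i)%:R *: e j = e i.
Proof.
rewrite (bigD1 i) //= eqxx scale1r big1 ?addr0 // => j /negPf ->.
by rewrite scale0r.
Qed.

Lemma basis_neq0 (i : I) : e i <> 0.
Proof.
move=> e0; have /(_ i) : (fun j => (j == i)%:R) =1 (fun=> 0 : K).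
  apply: basis_coef_eq; rewrite basis_elt e0 big1 // => j _.
  by rewrite scale0r.
by rewrite eqxx => /eqP; rewrite oner_eq0.
Qed.

Lemma basis_inj : injective e.
Proof.
move=> i j eij.
have /(_ i) : (fun k => (k == i)%:R : K) =1 (fun k => (k == j)%:R).
  by apply: basis_coef_eq; rewrite !basis_elt.
by rewrite eqxx; case: eqP => // _ /eqP; rewrite oner_eq0.
Qed.

End PartialMatching.

Section MatchedBasis.
Variables (R : realType) (K : fieldType).
Implicit Types V W : persistence_module R K.

(** Bases of all the spaces of a persistence module such that the structure maps
are partial injections between them. *)
Record matched_basis V := MatchedBasis {
  mb_index : R -> finType;
  mb_vec : forall t, mb_index t -> (V t : lmodType K);
  mb_is_basis : forall t, is_basis (@mb_vec t);
  mb_matched : forall (s t : R) (st : s <= t),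
    partial_matching (@mb_vec s) (@mb_vec t) (structure_map V st) }.

Lemma mb_vec_neq0 V (b : matched_basis V) (t : R) (i : mb_index b t) :
  mb_vec i <> 0.
Proof. exact: basis_neq0 (@mb_is_basis V b t) i. Qed.

Section Classes.
Variables (V : persistence_module R K) (b : matched_basis V).

Definition mb_point := {t : R & mb_index b t}.

Local Notation pt i := (Tagged (fun t : R => mb_index b t : Type) i).

Definition flows (x y : mb_point) : Prop :=
  exists st : tag x <= tag y,
    structure_map V st (mb_vec (tagged x)) = mb_vec (tagged y).

(** A single step of the flow, in either direction, is already transitive: two
points with a common future, or with a common past, flow one to the other. *)
Definition same_bar (x y : mb_point) : Prop := flows x y \/ flows y x.

Lemma flows_refl x : flows x x.
Proof. by exists (lexx _); rewrite structure_map_id. Qed.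

Lemma flows_trans y x z : flows x y -> flows y z -> flows x z.
Proof.
move=> [xy Exy] [yz Eyz]; exists (le_trans xy yz).
by rewrite -(structure_map_comp xy yz) Exy.
Qed.

Lemma flows_confluent x y z : flows x y -> flows x z -> tag y <= tag z ->
  flows y z.
Proof.
move=> [xy Exy] [xz Exz] yz; exists yz.
by rewrite -Exz -Exy (structure_map_comp xy yz xz).
Qed.

(** Injectivity of the matching: if x and y both reach z, the image of x at the
time of y is a basis vector that flows to z, hence it is y. *)
Lemma flows_cofluent x y z : flows x z -> flows y z -> tag x <= tag y ->
  flows x y.
Proof.
move=> [xz Exz] [yz Eyz] xy; exists xy.
have E := structure_map_comp xy yz xz (mb_vec (tagged x)).
have [M0 _] := mb_matched b xy; have [_ Minj] := mb_matched b yz.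
case: (M0 (tagged x)) => [x0|[i xi]].
  by case: (mb_vec_neq0 (i := tagged z)); rewrite -Exz -E x0 linear0.
by rewrite xi (Minj (tagged y) i (tagged z)) // -xi E.
Qed.

Lemma flows_between x y (u : R) : flows x y -> tag x <= u -> u <= tag y ->
  exists i : mb_index b u, flows x (pt i).
Proof.
move=> [xy Exy] xu uy; have [M0 _] := mb_matched b xu.
case: (M0 (tagged x)) => [x0|[i xi]]; last by exists i, xu.
case: (mb_vec_neq0 (i := tagged y)).
by rewrite -Exy -(structure_map_comp xu uy) x0 linear0.
Qed.

Lemma same_bar_sym x y : same_bar x y -> same_bar y x.
Proof. by case; [right|left]. Qed.

Lemma same_bar_trans y x z : same_bar x y -> same_bar y z -> same_bar x z.
Proof.
case=> xy; case=> yz.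
- by left; apply: flows_trans xy yz.
- have [xz|/ltW zx] := leP (tag x) (tag z).
    by left; apply: flows_cofluent xy yz xz.
  by right; apply: flows_cofluent yz xy zx.
- have [xz|/ltW zx] := leP (tag x) (tag z).
    by left; apply: flows_confluent xy yz xz.
  by right; apply: flows_confluent yz xy zx.
- by right; apply: flows_trans yz xy.
Qed.

Lemma same_bar_flows x y : same_bar x y -> tag x <= tag y -> flows x y.
Proof.
case=> // -[yx Eyx] xy.
case: x y yx Eyx xy => [s i] [t j] /= ts E st.
have tE : t = s by apply/eqP; rewrite eq_le ts st.
subst t; rewrite structure_map_id in E; exists st => /=.
by rewrite structure_map_id E.
Qed.

Lemma same_bar_time (t : R) (i j : mb_index b t) :
  same_bar (pt i) (pt j) -> i = j.
Proof.
move=> /same_bar_flows/(_ (lexx t))[tt /=]; rewrite structure_map_id.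
exact: basis_inj (@mb_is_basis _ b t) _ _.
Qed.

Definition bar_class_pred : pred (set mb_point) :=
  fun c => `[< exists x, c = same_bar x >].

Definition bar_class := {c : set mb_point | bar_class_pred c}.

Lemma class_of_subproof x : bar_class_pred (same_bar x : set mb_point).
Proof. by apply/asboolP; exists x. Qed.

Definition class_of (x : mb_point) : bar_class :=
  exist (fun c => bar_class_pred c) (same_bar x) (class_of_subproof x).

Implicit Type c : bar_class.

Lemma mem_class_of x : val (class_of x) x.
Proof. by left; apply: flows_refl. Qed.

Lemma class_same_bar c x y : val c x -> val c y -> same_bar x y.
Proof.
case: c => c /= /[dup] /asboolP[z ->] _ zx zy.
exact: same_bar_trans (same_bar_sym zx) zy.
Qed.

Lemma class_closed c x y : val c x -> same_bar x y -> val c y.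
Proof.
by case: c => c /= /[dup] /asboolP[z ->] _ zx /(same_bar_trans zx).
Qed.

Lemma class_ofE c x : val c x -> class_of x = c.
Proof.
move=> cx; apply/val_inj/seteqP; split=> y /=; first exact: class_closed.
exact: class_same_bar.
Qed.

Definition class_life c : set R :=
  [set t | exists i : mb_index b t, val c (pt i)].

Lemma class_life_nonempty c : class_life c !=set0.
Proof.
case: c => c cP; have /asboolP[[t i] cE] := cP; exists t, i => /=.
by rewrite cE; left; apply: flows_refl.
Qed.

Lemma class_life_interval c : is_interval (class_life c).
Proof.
move=> s t [i ci] [j cj] u /andP[su ut].
have ij := same_bar_flows (class_same_bar ci cj) (le_trans su ut).
have [k ik] := flows_between ij su ut; exists k.
by apply: class_closed ci _; left.
Qed.

Definition class_bar c : bar R :=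
  Bar (class_life_nonempty c) (@class_life_interval c).

Definition canonical_barcode : barcode R := @Barcode R bar_class class_bar.

Definition class_vec (t : R) c : (V t : lmodType K) :=
  if pselect (exists i : mb_index b t, val c (pt i)) is left h
  then mb_vec (projT1 (cid h)) else 0.

Lemma class_vecE (t : R) c (i : mb_index b t) :
  val c (pt i) -> class_vec t c = mb_vec i.
Proof.
move=> ci; rewrite /class_vec; case: pselect => [h|[]]; last by exists i.
case: cid => j /= cj; congr mb_vec.
exact/same_bar_time/(class_same_bar cj ci).
Qed.

Lemma class_vec_out (t : R) c : ~ class_life c t -> class_vec t c = 0.
Proof. by move=> nt; rewrite /class_vec; case: pselect. Qed.

(** A vector killed by the structure map from s to t has no member of its class
at time t, so the extension by 0 is compatible with the structure maps. *)
Lemma structure_map_class_vec (s t : R) (st : s <= t) c : class_life c s ->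
  structure_map V st (class_vec s c) = class_vec t c.
Proof.
move=> [i ci]; rewrite (class_vecE ci).
have [M0 _] := mb_matched b st; case: (M0 i) => [i0|[j ij]].
  rewrite class_vec_out // => -[j cj].
  have [st' /= E] := same_bar_flows (class_same_bar ci cj) st.
  apply: (mb_vec_neq0 (i := j)).
  by rewrite -E (bool_irrelevance st' st).
rewrite ij; apply/esym/class_vecE; apply: class_closed ci _.
by left; exists st.
Qed.

Definition class_map (t : R) c (w : 'rV[K]_(t \in bar_set (class_bar c))) :
    (V t : lmodType K) :=
  (\sum_k w 0 k) *: class_vec t c.

Lemma class_map_linear (t : R) c : linear (@class_map t c).
Proof.
move=> a v w; rewrite /class_map scalerA -scalerDl mulr_sumr -big_split /=.
by congr (_ *: _); apply: eq_bigr => k _; rewrite !mxE.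
Qed.

HB.instance Definition _ (t : R) c :=
  GRing.isLinear.Build K 'rV[K]_(t \in bar_set (class_bar c)) (V t : lmodType K)
    _ (@class_map t c) (@class_map_linear t c).

Lemma class_mapZ (t : R) c a w :
  class_map (t := t) (c := c) (a *: w) = a *: class_map w.
Proof. exact: linearZ. Qed.

Lemma class_map_const (t : R) c :
  class_map (t := t) (c := c) (const_mx 1) = class_vec t c.
Proof.
rewrite /class_map; have [_|/negP tc] := boolP (t \in bar_set (class_bar c)).
  rewrite (eq_bigr (fun=> 1)) => [|k _]; last by rewrite mxE.
  by rewrite sumr_const card_ord scale1r.
by rewrite class_vec_out ?scaler0 // => ct; apply: tc; exact: mem_set.
Qed.

Definition class_inj c : nat_trans (interval_module K (class_bar c)) V.
Proof.
exists (fun t : R => @class_map t c : {linear _ -> _}) => s t st.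
apply: linear_eq => w.
transitivity (class_map (w *m (pid_mx 1 : 'M[K]_(s \in bar_set (class_bar c),
    t \in bar_set (class_bar c))))) => //.
transitivity (structure_map V st (class_map w)) => //.
have [a ->] : exists a, w = a *: const_mx 1 by eexists; exact: row_boolE.
rewrite -scalemxAl !class_mapZ [RHS]linearZ /=; congr (a *: _).
rewrite const_row_bool_pid class_mapZ !class_map_const.
have [/set_mem cs|/negP ncs] := boolP (s \in bar_set (class_bar c)); last first.
  rewrite scale0r (@class_vec_out s) ?linear0 // => cs.
  by apply: ncs; exact: mem_set.
rewrite structure_map_class_vec //=.
have [_|/negP nct] := boolP (t \in bar_set (class_bar c)).
  by rewrite scale1r.
by rewrite class_vec_out ?scaler0 // => ct; apply: nct; exact: mem_set.
Defined.

Lemma class_of_inj (t : R) :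
  injective (fun i : mb_index b t => class_of (pt i)).
Proof.
move=> i j /= ij; apply/same_bar_time.
apply: (@class_same_bar (class_of (pt i))); first exact: mem_class_of.
by rewrite ij; exact: mem_class_of.
Qed.

Lemma classes_at (t : R) :
  [set c | class_life c t] =
  [set` [fset class_of (pt i) | i : mb_index b t]%fset].
Proof.
apply/seteqP; split=> c /=.
  by move=> [i ci]; apply/imfsetP; exists i => //; rewrite (class_ofE ci).
by move=> /imfsetP[i _ ->]; exists i; exact: mem_class_of.
Qed.

Lemma canonical_locally_finite : locally_finite canonical_barcode.
Proof. by move=> t; rewrite [X in finite_set X]classes_at. Qed.

(** The classes alive at t correspond bijectively to the basis vectors at t. *)
Lemma sum_classes (t : R) (F : bar_class -> (V t : lmodType K)) :
  (forall c, ~ class_life c t -> F c = 0) ->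
  \sum_(c \in [set: bar_class]) F c =
  \sum_(i : mb_index b t) F (class_of (pt i)).
Proof.
move=> F0; rewrite (fsbigTE [fset class_of (pt i) | i : mb_index b t]%fset).
  rewrite big_imfset /=; first by rewrite big_enum.
  by move=> i j _ _; exact: class_of_inj.
move=> c /negP nc; apply: F0.
rewrite -[class_life c t]/([set c | class_life c t] c) => ct; apply: nc.
by move: ct; rewrite classes_at.
Qed.

Theorem canonical_is_barcode : is_barcode_of canonical_barcode V.
Proof.
exists class_inj => t x.
have [a [xE a_uniq]] := @mb_is_basis _ b t x.
pose coef c : K :=
  if pselect (exists i : mb_index b t, val c (pt i)) is left h
  then a (projT1 (cid h)) else 0.
have coefE c i : val c (pt i) -> coef c = a i.
  move=> ci; rewrite /coef; case: pselect => [h|[]]; last by exists i.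
  case: cid => j /= cj; congr (a _).
  exact/same_bar_time/(class_same_bar cj ci).
pose w c : 'rV[K]_(t \in bar_set (class_bar c)) := coef c *: const_mx 1.
exists w; split.
  split.
    apply: (sub_finite_set _ (canonical_locally_finite t)) => c /= wc.
    apply: contrapT => nct; move/eqP : wc; apply; apply/rowP => k.
    by rewrite /w /coef; case: pselect => [//|_]; rewrite scale0r.
  rewrite (_ : (fun c => _) = fun c => class_map (w c)); last by [].
  rewrite sum_classes => [|c nct]; last first.
    by rewrite /class_map class_vec_out ?scaler0.
  rewrite xE; apply: eq_bigr => i _.
  rewrite /w class_mapZ class_map_const (class_vecE (i := i)) ?(coefE _ i) //;
  exact: mem_class_of.
move=> w' [_ xE']; apply: functional_extensionality_dep => c.
have : x = \sum_(i : mb_index b t)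
    (\sum_k w' (class_of (pt i)) 0 k) *: mb_vec i.
  rewrite xE' (_ : (fun c => _) = fun c => class_map (w' c)); last by [].
  rewrite sum_classes => [|d ndt]; last first.
    by rewrite /class_map class_vec_out ?scaler0.
  apply: eq_bigr => i _; rewrite /class_map (class_vecE (i := i)) //.
  exact: mem_class_of.
rewrite xE => /(basis_coef_eq (@mb_is_basis _ b t)) aE.
rewrite /w [RHS]row_boolE; have [[i ci]|nct] := pselect (class_life c t).
  by rewrite (coefE c i ci) aE (class_ofE ci).
apply/rowP => -[k kt]; exfalso; move: kt.
by rewrite (_ : t \in _ = false) //; apply/negP => /set_mem.
Qed.

End Classes.
End MatchedBasis.

(** * Stability for matched interleavings *)

Section Endpoints.
Variable R : realType.
Implicit Types (J : bar R) (e : R).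

Lemma bar_inf_le J J' e :
  (forall s, bar_set J s -> exists2 s', bar_set J' s' & s' <= s + e) ->
  (bar_inf J' <= bar_inf J + e%:E)%E.
Proof.
move=> JJ'; rewrite -leeBlDr //; apply: le_ereal_inf_tmp => _ [s Js <-].
have [s' J's' s's] := JJ' s Js; rewrite leeBlDr // -EFinD.
by apply: ge_ereal_inf; exists s'%:E; [exists s'|rewrite lee_fin].
Qed.

Lemma bar_sup_le J J' e :
  (forall s', bar_set J' s' -> exists2 s, bar_set J s & s' <= s + e) ->
  (bar_sup J' <= bar_sup J + e%:E)%E.
Proof.
move=> JJ'; apply: ge_ereal_sup => _ [s' /JJ'[s Js s's] <-].
apply: (@le_trans _ _ (s%:E + e%:E)%E); first by rewrite -EFinD lee_fin.
by rewrite leeD2r //; apply: ereal_sup_ubound; exists s.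
Qed.

(** Convexity turns the absence of a pair s, s + 2e in the bar into a bound on
its length. *)
Lemma bar_short J e : 0 <= e ->
  (forall s, bar_set J s -> ~ bar_set J (s + e + e)) ->
  (bar_sup J <= bar_inf J + (2 * e)%:E)%E.
Proof.
move=> e0 short; apply: ge_ereal_sup => _ [t Jt <-].
rewrite -leeBlDr //; apply: le_ereal_inf_tmp => _ [s Js <-].
rewrite leeBlDr // -EFinD lee_fin mulr2n mulrDl !mul1r addrA leNgt.
apply/negP => st; apply: (short s Js); apply: (bar_interval Js Jt).
by rewrite (ltW st) andbT -addrA lerDl addr_ge0.
Qed.

End Endpoints.

(** Matchings see a bar only through its set of points, so they can be
transported along bijections that preserve these sets. *)
Lemma matching_reindex (R : realType) (e : R) (B B' C C' : barcode R)
    (f : B -> B') (g : C -> C') (m : B' -> C' -> Prop) :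
  bijective f -> bijective g ->
  (forall i, bar_set (bar_of (f i)) = bar_set (bar_of i)) ->
  (forall j, bar_set (bar_of (g j)) = bar_set (bar_of j)) ->
  is_matching e m -> is_matching e (fun i j => m (f i) (g j)).
Proof.
move=> fbij gbij fE gE [m1 m2 m3 m4 m5].
have infE (D D' : barcode R) (h : D -> D') i :
    bar_set (bar_of (h i)) = bar_set (bar_of i) ->
    bar_inf (bar_of (h i)) = bar_inf (bar_of i) /\
    bar_sup (bar_of (h i)) = bar_sup (bar_of i).
  by rewrite /bar_inf /bar_sup => ->.
split.
- by move=> i j j' ij ij'; apply: (bij_inj gbij); exact: m1 ij ij'.
- by move=> i i' j ij ij'; apply: (bij_inj fbij); exact: m2 ij ij'.
- move=> i j /m3.
  by have [-> ->] := infE _ _ f i (fE i); have [-> ->] := infE _ _ g j (gE j).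
- move=> i nij; have [<- <-] := infE _ _ f i (fE i); apply: m4 => -[j' ij'].
  have [g' _ g'K] := gbij.
  by apply: nij; exists (g' j'); rewrite g'K.
- move=> j nij; have [<- <-] := infE _ _ g j (gE j); apply: m5 => -[i' i'j].
  have [f' _ f'K] := fbij.
  by apply: nij; exists (f' i'); rewrite f'K.
Qed.

Section Links.
Variables (R : realType) (K : fieldType).
Implicit Types V W : persistence_module R K.

Local Notation pt i := (Tagged (fun t : R => mb_index _ t : Type) i).

Definition shift_map V W (e : R) (u : nat_trans V (Defs.shift e W)) (a : R) :
    {linear (V a : lmodType K) -> (W (a + e) : lmodType K)} := u a.

Lemma shift_map_natural V W (e : R) (u : nat_trans V (Defs.shift e W)) (s t : R)
    (st : s <= t) (ste : s + e <= t + e) x :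
  shift_map u t (structure_map V st x) = structure_map W ste (shift_map u s x).
Proof.
have := congr1 (fun f : {linear (V s : lmodType K) ->
    (W (t + e) : lmodType K)} => f x) (naturality u (rle st)).
rewrite /= /structure_map (bool_irrelevance ste (lerD st (lexx e))).
by move=> H; exact: H.
Qed.

Section Link.
Variables (V W : persistence_module R K).
Variables (b : matched_basis V) (b' : matched_basis W).
Variables (e : R) (u : nat_trans V (Defs.shift e W)).
Hypothesis u_matched : forall a : R,
  partial_matching (@mb_vec _ _ _ b a) (@mb_vec _ _ _ b' (a + e))
    (shift_map u a).

Definition link (c : canonical_barcode b) (d : canonical_barcode b') : Prop :=
  exists (a : R) (i : mb_index b a) (j : mb_index b' (a + e)),
    [/\ val c (pt i), val d (pt j) & shift_map u a (mb_vec i) = mb_vec j].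

Lemma link_flows_target (s t : R) (i : mb_index b s) (i' : mb_index b t)
    (j : mb_index b' (s + e)) (j' : mb_index b' (t + e)) :
  shift_map u s (mb_vec i) = mb_vec j ->
  shift_map u t (mb_vec i') = mb_vec j' ->
  flows (pt i) (pt i') -> flows (pt j) (pt j').
Proof.
move=> ij ij' [/= st Eii']; exists (lerD st (lexx e)) => /=.
by rewrite -ij -(shift_map_natural u st) Eii'.
Qed.

(** Going back uses more than naturality: the flow of i to time t must survive,
since u sends it to the nonzero vector j', and injectivity of u at time t then
identifies it with i'. *)
Lemma link_flows_source (s t : R) (i : mb_index b s) (i' : mb_index b t)
    (j : mb_index b' (s + e)) (j' : mb_index b' (t + e)) :
  shift_map u s (mb_vec i) = mb_vec j ->
  shift_map u t (mb_vec i') = mb_vec j' ->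
  flows (pt j) (pt j') -> flows (pt i) (pt i').
Proof.
move=> ij ij' [/= ste Ejj']; have st : s <= t by rewrite -(lerD2r e).
exists st => /=; move: Ejj'; rewrite -ij -(shift_map_natural u st) => E.
have [/(_ i)[i0|[k ik]] _] := mb_matched b st.
  by case: (mb_vec_neq0 (i := j')); rewrite -E i0 linear0.
have [_ u_inj] := u_matched t.
by rewrite ik (u_inj k i' j') // -ik.
Qed.

Lemma link_functional c d d' : link c d -> link c d' -> d = d'.
Proof.
move=> [s [i [j [ci dj ij]]]] [t [i' [j' [ci' dj' ij']]]].
rewrite -(class_ofE dj) -(class_ofE dj'); apply: class_ofE.
apply: (same_bar_sym (x := pt j)).
case: (class_same_bar ci ci') => ii'; [left|right];
exact: link_flows_target ii'.
Qed.

Lemma link_injective c c' d : link c d -> link c' d -> c = c'.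
Proof.
move=> [s [i [j [ci dj ij]]]] [t [i' [j' [ci' dj' ij']]]].
rewrite -(class_ofE ci) -(class_ofE ci'); apply: class_ofE.
apply: (same_bar_sym (x := pt i)).
case: (class_same_bar dj dj') => jj'; [left|right];
exact: link_flows_source jj'.
Qed.

(** Let a be the time of the link. A member k of c at an earlier time s flows to
the source of the link, so u cannot kill k, and its image is a member of d at
time s + e. *)
Lemma link_inf c d : link c d ->
  (bar_inf (bar_of d) <= bar_inf (bar_of c) + e%:E)%E.
Proof.
move=> [a [i [j [ci dj ij]]]]; apply: bar_inf_le => s [k ck].
have [sa|as_] := leP s a; last first.
  by exists (a + e); [exists j|rewrite lerD2r ltW].
exists (s + e) => //.
have [sa' /= Eki] := same_bar_flows (class_same_bar ck ci) sa.
have E := shift_map_natural u sa' (lerD sa' (lexx e)) (mb_vec k).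
rewrite Eki ij in E; case: (u_matched s) => /(_ k)[k0|[l kl]] _.
  by case: (mb_vec_neq0 (i := j)); rewrite E k0 linear0.
exists l; apply: class_closed dj _; right; exists (lerD sa' (lexx e)) => /=.
by rewrite -kl -E.
Qed.

(** Let a be the time of the link. If a member of d lives at t + e with t after
a, naturality shows that the structure map from a to t does not kill the source
of the link. *)
Lemma link_sup c d : link c d ->
  (bar_sup (bar_of d) <= bar_sup (bar_of c) + e%:E)%E.
Proof.
move=> [a [i [j [ci dj ij]]]]; apply: bar_sup_le => s' [l dl].
have [t s'E] : exists t, s' = t + e by exists (s' - e); rewrite subrK.
subst s'; have [ta|/ltW at_] := leP t a.
  by exists a; [exists i|rewrite lerD2r].
exists t => //.
have ate : a + e <= t + e by rewrite lerD2r.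
have [ate' /= Ejl] := same_bar_flows (class_same_bar dj dl) ate.
have E := shift_map_natural u at_ ate' (mb_vec i); rewrite ij Ejl in E.
have [/(_ i)[i0|[k ik]] _] := mb_matched b at_.
  by case: (mb_vec_neq0 (i := l)); rewrite -E i0 linear0.
by exists k; apply: class_closed ci _; left; exists at_.
Qed.

End Link.

Section Stability.
Variables (V W : persistence_module R K).
Variables (b : matched_basis V) (b' : matched_basis W).
Variables (e : R) (u : nat_trans V (Defs.shift e W)).
Variable v : nat_trans W (Defs.shift e V).
Hypothesis u_matched : forall a : R,
  partial_matching (@mb_vec _ _ _ b a) (@mb_vec _ _ _ b' (a + e))
    (shift_map u a).

(** The vector of c at t survives to t + 2e, and this structure map factors
through W, so u sends it to a vector of W; the class of that vector is d. *)
Lemma link_long (c : canonical_barcode b) (t : R) (h : t <= t + e + e) :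
  (forall x, shift_map v (t + e) (shift_map u t x) = structure_map V h x) ->
  bar_set (bar_of c) t -> bar_set (bar_of c) (t + e + e) ->
  exists d : canonical_barcode b', link u c d /\ link v d c.
Proof.
move=> vu [i ci] [k ck].
have [h' /= Eik] := same_bar_flows (class_same_bar ci ck) h.
rewrite (bool_irrelevance h' h) -vu in Eik.
have [/(_ i)[i0|[j ij]] _] := u_matched t.
  by case: (mb_vec_neq0 (i := k)); rewrite -Eik i0 linear0.
exists (class_of (b := b') (pt j)); split.
  by exists t, i, j; split => //; exact: mem_class_of.
exists (t + e), j, k; split; [exact: mem_class_of|exact: ck|].
by rewrite -Eik ij.
Qed.

End Stability.

Theorem matched_interleaving_matching V W (b : matched_basis V)
    (b' : matched_basis W) (e : R) (u : nat_trans V (Defs.shift e W))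
    (v : nat_trans W (Defs.shift e V)) : 0 <= e ->
  (forall a : R, partial_matching (@mb_vec _ _ _ b a) (@mb_vec _ _ _ b' (a + e))
     (shift_map u a)) ->
  (forall a : R, partial_matching (@mb_vec _ _ _ b' a) (@mb_vec _ _ _ b (a + e))
     (shift_map v a)) ->
  (forall (a : R) (h : a <= a + e + e) x,
     shift_map v (a + e) (shift_map u a x) = structure_map V h x) ->
  (forall (a : R) (h : a <= a + e + e) x,
     shift_map u (a + e) (shift_map v a x) = structure_map W h x) ->
  is_matching e (B := canonical_barcode b) (C := canonical_barcode b')
    (fun c d => link u c d /\ link v d c).
Proof.
move=> e0 um vm vu uv.
have le2 (a : R) : a <= a + e + e by rewrite -addrA lerDl addr_ge0.
split.
- by move=> c d d' [cd _] [cd' _]; exact: link_functional cd cd'.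
- by move=> c c' d [cd _] [cd' _]; exact: link_injective um _ _ _ cd cd'.
- move=> c d [cd dc]; split; split.
  + exact: link_inf vm _ _ dc.
  + exact: link_inf um _ _ cd.
  + exact: link_sup dc.
  + exact: link_sup cd.
- move=> c unmatched; apply: bar_short => // s cs cs2; apply: unmatched.
  exact: link_long um _ _ _ (vu s (le2 s)) cs cs2.
- move=> d unmatched; apply: bar_short => // s ds ds2; apply: unmatched.
  have [c [dc cd]] := link_long vm (uv s (le2 s)) ds ds2.
  by exists c.
Qed.

End Links.

(** * Symmetry modules *)

Section Symmetry.
Variables (R : realType) (M : metricType R) (n : nat) (K : fieldType).

Definition sym_vec (X : config M n) (p : sym_index X) : sym_space K X :=
  sym_basis K (val p).

Lemma sym_vec_is_basis (X : config M n) : is_basis (@sym_vec X).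
Proof.
move=> x; exists (x : {ffun sym_index X -> K^o}); split.
  exact: sym_basis_sum.
move=> c ->; apply/ffunP => q; rewrite sum_ffunE (bigD1 q) //= big1 ?addr0.
  by rewrite !ffunE eqxx -[LHS]/(_ * 1) mulr1.
move=> p pq; rewrite !ffunE (_ : (val q == val p) = false) ?scaler0 //.
by apply: contraNF pq => /eqP/val_inj ->.
Qed.

Lemma conjugate_injective (X Y : config M n) (f : config_hom X Y) :
  injective (Defs.conjugate f).
Proof.
move=> p q /permP pq; apply/permP => x; have := pq (f x).
by rewrite !permE chomK => /(can_inj (chomK f)).
Qed.

Definition sym_elt (X : config M n) (p : {perm points X})
    (pS : p \in Defs.Sym X) : sym_index X :=
  exist (fun q : {perm points X} => q \in Defs.Sym X) p pS.

(** Basis vectors in L_{r,s} go to their conjugates, the others to 0, and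
conjugation by a bijection is injective. *)
Lemma sym_map_matched (A B : dyn_obj M n) (f : dyn_hom A B) :
  partial_matching (@sym_vec (A (dyn_end A))) (@sym_vec (B (dyn_end B)))
    (sym_map (K := K) f).
Proof.
split=> [p|p q r].
  rewrite /sym_vec sym_map_basis; last exact: valP.
  case: asboolP => [/sym_liftP[_ fp]|_]; last by left.
  by right; exists (sym_elt (fp _ (dyn_le f) (lexx _))).
have r0 := basis_neq0 (@sym_vec_is_basis _) (i := r).
rewrite /sym_vec !sym_map_basis; try exact: valP.
case: asboolP => [fp|_ /esym/r0 //]; case: asboolP => [fq|_ _ /esym/r0 //].
have basis_elt_inj s t :
    s \in Defs.Sym (B (dyn_end B)) -> t \in Defs.Sym (B (dyn_end B)) ->
    sym_basis K s = sym_basis K t -> s = t.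
  move=> sS tS st.
  have : sym_vec (sym_elt sS) = sym_vec (sym_elt tS).
    exact: st.
  by move=> /(basis_inj (@sym_vec_is_basis _))/(congr1 val).
have conjS s : sym_lift f s ->
    Defs.conjugate (dyn_map f (dyn_le f)) s \in Defs.Sym (B (dyn_end B)).
  by move=> /sym_liftP[_]; apply.
move=> pr qr; apply/val_inj/(@conjugate_injective _ _ (dyn_map f (dyn_le f))).
by apply: basis_elt_inj; [exact: conjS|exact: conjS|rewrite pr qr].
Qed.

Definition symmetry_module (P : persistence_dynamical_system M n) :
    persistence_module R K :=
  functor_comp (sym_functor M n K) P.

Definition symmetry_basis (P : persistence_dynamical_system M n) :
  matched_basis (symmetry_module P).
Proof.
exists (fun t => sym_index ((P t : dyn_obj M n) (dyn_end (P t))) : finType)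
  (fun t => @sym_vec _).
- by move=> t; exact: sym_vec_is_basis.
- by move=> s t st; exact: sym_map_matched.
Defined.

(** The existence of the canonical barcode also shows that the symmetry barcode
is not the dummy value of [barcode_of]. *)
Lemma SymB_canonical (P : persistence_dynamical_system M n) :
  exists f : SymB K P -> canonical_barcode (symmetry_basis P),
    bijective f /\ forall i, bar_set (bar_of (f i)) = bar_set (bar_of i).
Proof.
have canP := canonical_is_barcode (symmetry_basis P).
apply: (@barcode_unique _ _ (symmetry_module P)) => //; last first.
  exact: canonical_locally_finite.
rewrite /SymB /barcode_of; case: pselect => [h|[]]; first by case: cid.
by exists (canonical_barcode (symmetry_basis P)).
Qed.

(** Whiskering with [sym_functor] commutes with shifting. *)
Definition symmetry_shift (P Q : persistence_dynamical_system M n) (e : R)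
    (u : nat_trans P (Defs.shift e Q)) :
  nat_trans (symmetry_module P) (Defs.shift e (symmetry_module Q)).
Proof.
exists (fun a => Defs.fmap (sym_functor M n K) (u a)) => a b f.
transitivity (Defs.fmap (sym_functor M n K) (Defs.comp (u b) (Defs.fmap P f))).
  by rewrite fmapM.
by rewrite naturality fmapM.
Defined.

Lemma interleaved_symmetry (P Q : persistence_dynamical_system M n) (e : R)
    (u : nat_trans P (Defs.shift e Q)) (v : nat_trans Q (Defs.shift e P))
    (a : R) (h : a <= a + e + e) x :
  Defs.comp (v (a + e)) (u a) = Defs.fmap P (rle h) ->
  shift_map (symmetry_shift v) (a + e) (shift_map (symmetry_shift u) a x) =
  structure_map (symmetry_module P) h x.
Proof.
move=> /(congr1 (fun f => Defs.fmap (sym_functor M n K) f)).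
rewrite fmapM => E.
have := congr1 (fun f : {linear (symmetry_module P a : lmodType K) ->
  (symmetry_module P (a + e + e) : lmodType K)} => f x) E.
by move=> /= H; exact: H.
Qed.

End Symmetry.

Theorem proposition1p5p7 (R : realType) (M : metricType R) (n : nat)
    (hn : (2 <= n)%N) (K : fieldType)
    (P Q : persistence_dynamical_system M n) :
  (bottleneck_distance (SymB K P) (SymB K Q) <= interleaving_distance P Q)%E.
Proof.
have [f [fbij fE]] := SymB_canonical K P.
have [g [gbij gE]] := SymB_canonical K Q.
apply: le_ereal_inf => _ [e [e0 [u [v uv]]] <-]; exists e => //; split => //.
exists (fun i j => link (symmetry_shift K u) (f i) (g j) /\
  link (symmetry_shift K v) (g j) (f i)).
apply: (matching_reindex (m := fun c d => link _ c d /\ link _ d c)) => //.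
apply: matched_interleaving_matching => //.
- by move=> a; exact: sym_map_matched.
- by move=> a; exact: sym_map_matched.
- by move=> a h x; apply: interleaved_symmetry; have [] := uv a h.
- by move=> a h x; apply: interleaved_symmetry; have [] := uv a h.
Qed.
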